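(* Let $d$ be a positive integer. There exists $C_d>0$ such that for all positive integers $n,r$ the following holds. For $N\ge r^{r^{C_d r n^{d}}}$, every $r$-colouring of the edges of $\square^{d}K_N$ contains a copy of $\square^{d}K_n$ which is monochromatic in every direction. That is, $R_r(d,n)\le r^{r^{C_d r n^{d}}}$.
   Context: For a positive integer $N$, $[N]=\{1,\dots,N\}$, and $K_N$ is the complete graph on vertex set $[N]$. The Cartesian product $\square^{d}K_N$ of $d$ copies of $K_N$ is the graph with vertex set $[N]^d$ in which $v=(v_1,\dots,v_d)$ and $w=(w_1,\dots,w_d)$ are adjacent if and only if they differ in exactly one coordinate; if they differ exactly in coordinate $i$, the edge $vw$ is said to be in direction $i$. A copy of $\square^{d}K_n$ in $\square^{d}K_N$ means a full-dimensional sub-product: the subgraph induced on $A_1\times\dots\times A_d$ for some sets $A_1,\dots,A_d\subseteq[N]$ with $|A_i|=n$ for every $i$ (its directions are the directions of $\square^d K_N$). An $r$-colouring is an arbitrary assignment of one of $r$ colours to each edge. A copy is monochromatic in every direction if for each $i\in\{1,\dots,d\}$ there is a colour $c_i$ such that all edges of the copy in direction $i$ have colour $c_i$ (the colours $c_i$ may differ for different $i$). For positive integers $r,d$, $R_r(d,n)$ denotes the smallest $N$ such that every $r$-colouring of the edges of $\square^{d}K_N$ contains a copy of $\square^{d}K_n$ that is monochromatic in every direction.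
   Formalization: The formal theorem assumes r ≥ 2 or n = 1: for r = 1 and n ≥ 2 the bound equals 1, yet for N = 1 the graph has a single vertex and contains no copy of □^d K_n, so the claim as stated fails there. *)

(* Defs.v *)
From mathcomp Require Import all_boot all_order all_algebra.
From mathcomp Require Import all_classical all_reals all_analysis.

Set Implicit Arguments.
Unset Strict Implicit.
Unset Printing Implicit Defensive.

(* [N] and {1, ..., d} are represented by 'I_N and 'I_d, i.e., shifted to start
   at 0. *)
Definition vertex (d N : nat) := {ffun 'I_d -> 'I_N}.

Definition diff_coords d N (v w : vertex d N) : {set 'I_d} :=
  [set i | v i != w i].

Definition box_adj d N : rel (vertex d N) :=
  fun v w => #|diff_coords v w| == 1.

Definition is_edge d N (e : {set vertex d N}) : bool :=
  [exists v, exists w, box_adj v w && (e == [set v; w])].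

Definition edge (d N : nat) := {e : {set vertex d N} | is_edge e}.

Definition in_direction d N (e : edge d N) (i : 'I_d) : bool :=
  [exists v, exists w,
    (diff_coords v w == [set i]) && (val e == [set v; w])].

Definition subbox d N (A : 'I_d -> {set 'I_N}) : {set vertex d N} :=
  [set v | v \in family A].

Definition monochromatic_in_every_direction r d N
    (c : edge d N -> 'I_r) (A : 'I_d -> {set 'I_N}) : Prop :=
  forall i : 'I_d, exists ci : 'I_r, forall e : edge d N,
    val e \subset subbox A -> in_direction e i -> c e = ci.

Definition ramsey_property (r d n N : nat) : Prop :=
  forall c : edge d N -> 'I_r, exists A : 'I_d -> {set 'I_N},
    (forall i, #|A i| = n) /\ monochromatic_in_every_direction c A.

(* M = R_r(d,n).  A relation rather than a function, so that asserting it also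
   asserts that the minimum exists. *)
Definition is_ramsey_number (r d n M : nat) : Prop :=
  ramsey_property r d n M /\
  forall N : nat, ramsey_property r d n N -> M <= N.

(* Main.v *)
Require Import Defs.
From mathcomp Require Import all_boot.
From mathcomp Require boolp.
From mathcomp Require Import zify.

(** Number the directions from 0 to d, so that the dimension is d + 1, and write
    c i x b for the colour of the edge in direction i from the vertex x to the
    vertex whose i-th coordinate is b; only edges with x_i < b matter, the
    others being read from their other end.  The idea is to spend a doubly
    exponential number of coordinates on turning the edge colours of all
    directions but 0 into vertex colours, and then to solve the remaining
    problem, whose scale is singly exponential.

    First step (source_determined_exists).  Fix sizes L_0, ..., L_d.  There are
    sets S_k of size L_k such that, inside the sub-box S_0 x ... x S_d, the
    colour of an edge in a direction i > 0 depends only on its lower endpoint x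
    and not on b.  The coordinates are treated one after the other: for every
    value z of coordinate j, the slice at z has suitable sets S_k for k < j.
    Since these sets lie in small ranges [P_k], few families of them exist, and
    the pigeonhole principle gives many z with the same sets S_0, ..., S_(j-1).
    Among these z, the edges in direction j form a complete graph, coloured by
    the vectors of colours indexed by the vertices of S_0 x ... x S_(j-1).  The
    argument of Erdos and Rado (min_colouring) then finds L_j values such that
    the vector at a < b depends only on a.  It costs an exponential in L_j times
    the number of those vertices, and this is the only exponential loss from the
    L_k to the P_k.

    Second step (aligned_exists).  By the first step every vertex of the sub-box
    carries a colour for each direction i > 0.  For fixed values of the
    coordinates k > 0, pigeonhole on these vertex colours leaves r^(r n) values
    of coordinate 0, and Ramsey's theorem for direction 0 gives n of them that
    form a monochromatic clique on which the vertex colours are constant.  Again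
    one coordinate after the other, the pigeonhole principle makes the chosen
    n-sets and colours agree for n values of the next coordinate.

    Sizes.  The second step asks that L_j be at least n r^(d+1) times the product
    of the L_k^n for k < j.  So the exponent of L_j as a power of r starts at
    order r n and is multiplied by O(n) when j grows by one: the largest of them
    is of order r n n^d, which is r n^(d+1).  The first step then needs P_j of
    the form r^(L_d^O(d)). *)

(** * Pigeonhole and Ramsey arguments on finite sets *)

Lemma subset_of_card {T : finType} (A : {set T}) (m : nat) :
  m <= #|A| -> exists2 B : {set T}, B \subset A & #|B| = m.
Proof.
case/card_geqP=> s [us <- sA]; exists [set x in s].
  by apply/subsetP=> x; rewrite inE => /sA.
by rewrite cardsE; apply/card_uniqP.
Qed.

Lemma bin_leq_expn (n m : nat) : 'C(n, m) <= n ^ m.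
Proof.
have h : n ^_ m <= n ^ m.
  by elim: m => // m IHm; rewrite ffactnSr expnSr leq_mul // leq_subr.
by apply: leq_trans h; rewrite -bin_ffact leq_pmulr ?fact_gt0.
Qed.

(** Stated with a set of values containing the image rather than with the whole
    type K, because the families of subsets counted below are few only when
    restricted to the relevant ranges. *)
Lemma pigeonhole {T K : finType} (D : {set K}) (g : T -> K) (Z : {set T}) :
  (forall z, z \in Z -> g z \in D) ->
  exists2 Z' : {set T}, Z' \subset Z &
    #|Z| <= #|D| * #|Z'| /\ {in Z' &, forall z z', g z = g z'}.
Proof.
move=> gD; pose F k := [set z in Z | g z == k].
have cardZ : #|Z| = \sum_(k in D) #|F k|.
  rewrite -sum1_card (partition_big g (mem D)) //=.
  by apply: eq_bigr => k _; rewrite -sum1_card; apply: eq_bigl => z; rewrite inE.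
case: (posnP #|D|) => [D0|Dgt0].
  exists set0; first exact: sub0set.
  split=> [|z z']; last by rewrite inE.
  by rewrite cardZ big_pred0 // => k; rewrite (cards0_eq D0) inE.
have [k kD kmax] := eq_bigmax_cond (fun k => #|F k|) Dgt0.
exists (F k); first by apply/subsetP=> z; rewrite inE => /andP[].
split; last by move=> z z'; rewrite !inE => /andP[_ /eqP ->] /andP[_ /eqP ->].
by rewrite -kmax cardZ -sum_nat_const; apply: leq_sum => i iD; exact: leq_bigmax_cond.
Qed.

(** The argument of Erdos and Rado: put the least element a of Z into Y, keep the
    largest class of elements b with the same colour chi a b, and repeat.  Each
    round divides the size by about k, and 1 < k makes up for the loss of a
    itself. *)
Lemma min_colouring {N : nat} {K : finType} (chi : 'I_N -> 'I_N -> K)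
    (k m : nat) (Z : {set 'I_N}) :
  1 < k -> #|K| <= k -> k ^ m <= #|Z| ->
  exists2 Y : {set 'I_N}, Y \subset Z &
    #|Y| = m /\ exists f : 'I_N -> K,
      forall a b : 'I_N, a \in Y -> b \in Y -> a < b -> chi a b = f a.
Proof.
move=> k1 Kk; elim: m Z => [|m IHm] Z hZ.
  exists set0; first exact: sub0set.
  by rewrite cards0; split=> //; exists (fun a => chi a a) => a b; rewrite inE.
have /card_gt0P [x0 x0Z] : 0 < #|Z| by apply: leq_trans hZ; rewrite expn_gt0 ltnW.
case: (arg_minnP (fun x : 'I_N => val x) x0Z) => a aZ amin.
have {}aZ : a \in Z := aZ.
have [Z' Z'Z [cardZ' Z'const]] :=
  @pigeonhole _ _ [set: K] (chi a) (Z :\ a) (fun z _ => in_setT _).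
have hZ' : k ^ m <= #|Z'|.
  have : k ^ m.+1 <= 1 + k * #|Z'|.
    apply: (leq_trans hZ); rewrite (cardsD1 a Z) aZ leq_add2l.
    by apply: leq_trans cardZ' _; rewrite cardsT leq_mul2r Kk orbT.
  by rewrite expnS; nia.
have /card_gt0P [z0 z0Z'] : 0 < #|Z'| by apply: leq_trans hZ'; rewrite expn_gt0 ltnW.
have [Y YZ' [cardY [f fP]]] := IHm _ hZ'.
have sub z : z \in Y -> z \in Z' by move/(subsetP YZ').
have aY z : z \in Y -> z \in Z /\ a < z.
  move=> /sub /(subsetP Z'Z); rewrite !inE => /andP[za zZ]; split=> //.
  by rewrite ltn_neqAle amin // andbT eq_sym.
exists (a |: Y).
  by apply/subsetP=> z; rewrite !inE => /predU1P[->//|/aY[]].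
split; first by rewrite cardsU1 cardY; case: (boolP (a \in Y)) => // /aY[_]; rewrite ltnn.
exists (fun x => if x == a then chi a z0 else f x) => x y.
rewrite !inE; case: (eqVneq x a) => [->|xa] /= xY.
  case: eqVneq => [->|ya] /=; first by rewrite ltnn.
  by move=> /sub yZ' _; apply: Z'const.
case: eqVneq => [->|ya] /= yY; last exact: fP.
by move=> xa'; have [_] := aY _ xY; rewrite ltnNge ltnW.
Qed.

(** Applied to a set on which the colour of an edge depends only on its lower end,
    the pigeonhole principle on the lower ends yields a monochromatic clique. *)
Lemma ramsey {N r : nat} (chi : 'I_N -> 'I_N -> 'I_r) (n : nat) (Z : {set 'I_N}) :
  1 < r -> 0 < n -> r ^ (r * n) <= #|Z| ->
  exists2 Y : {set 'I_N}, Y \subset Z &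
    #|Y| = n /\ exists k : 'I_r,
      forall a b : 'I_N, a \in Y -> b \in Y -> a < b -> chi a b = k.
Proof.
move=> r1 n0 hZ.
have hr : #|'I_r| <= r by rewrite card_ord.
have [Y YZ [cardY [f fP]]] := min_colouring chi r (r * n) Z r1 hr hZ.
have [Y' Y'Y [cardY' fconst]] :=
  @pigeonhole _ _ [set: 'I_r] f Y (fun z _ => in_setT _).
move: cardY'; rewrite cardY cardsT card_ord leq_pmul2l ?(ltnW r1) // => nY'.
have [A AY' cardA] := subset_of_card _ _ nY'.
have [z0 z0A] : exists z0, z0 \in A by apply/card_gt0P; rewrite cardA.
have sY z : z \in A -> z \in Y by move=> /(subsetP AY') /(subsetP Y'Y).
exists A; first exact: subset_trans AY' (subset_trans Y'Y YZ).
split=> //; exists (f z0) => a b aA bA ab; rewrite (fP a b) ?sY //.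
by apply: fconst; apply: (subsetP AY').
Qed.

Definition initial {N : nat} (m : nat) : {set 'I_N} := [set z : 'I_N | z < m].

Lemma card_initial (N m : nat) : m <= N -> #|@initial N m| = m.
Proof.
move=> mN; have inj_widen : injective (widen_ord mN) by move=> y z [] /val_inj.
rewrite -[RHS]card_ord -(card_imset _ (inj_widen)).
congr #|pred_of_set _|; apply/setP=> z; rewrite inE; apply/idP/imsetP => [zm|[y _ ->]].
  by exists (Ordinal zm) => //; apply: val_inj.
exact: (ltn_ord y).
Qed.

(** * Sub-boxes *)

Definition upd {I : finType} {V : Type} (x : {ffun I -> V}) (j : I) (z : V) :
  {ffun I -> V} := [ffun k => if k == j then z else x k].

Lemma updE {I : finType} {V : Type} (x : {ffun I -> V}) j z k :
  upd x j z k = if k == j then z else x k.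
Proof. exact: ffunE. Qed.

Lemma updK {d N : nat} (x : vertex d N) (j : 'I_d) : upd x j (x j) = x.
Proof. by apply/ffunP => k; rewrite updE; case: eqVneq => [->|]. Qed.

Lemma upd_upd {d N : nat} (x : vertex d N) (j : 'I_d) (z z' : 'I_N) :
  upd (upd x j z) j z' = upd x j z'.
Proof. by apply/ffunP => k; rewrite !updE; case: eqVneq. Qed.

Lemma subboxP {d N : nat} (A : 'I_d -> {set 'I_N}) (x : vertex d N) :
  reflect (forall k, x k \in A k) (x \in subbox A).
Proof. by rewrite inE; apply: familyP. Qed.

Lemma card_subbox {d N : nat} (A : 'I_d -> {set 'I_N}) :
  #|subbox A| = \prod_k #|A k|.
Proof. by rewrite cardsE card_family foldrE big_image. Qed.

(** Each z comes with a sub-box, to be compared with the others in all coordinates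
    except j, and with a label.  Direction k allows at most |U k|^(m k) sides,
    this being a bound for the number of subsets of size m k of U k. *)
Lemma pigeonhole_subboxes {d N : nat} {K : finType} (j : 'I_d)
    (U : 'I_d -> {set 'I_N}) (m : 'I_d -> nat)
    (B : 'I_N -> {ffun 'I_d -> {set 'I_N}}) (lab : 'I_N -> K) (Z : {set 'I_N}) :
  (forall z k, z \in Z -> k != j -> B z k \subset U k /\ #|B z k| = m k) ->
  exists2 Z' : {set 'I_N}, Z' \subset Z &
    #|Z| <= #|K| * (\prod_(k | k != j) #|U k| ^ m k) * #|Z'| /\
    forall z z' : 'I_N, z \in Z' -> z' \in Z' ->
      lab z = lab z' /\ forall k, k != j -> B z k = B z' k.
Proof.
move=> hB.
(* Side j is replaced by the empty set, so that it has no part in the count. *)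
pose F k := if k == j then [set set0] else [set S : {set 'I_N} | S \subset U k & #|S| == m k].
pose D := [set p : K * {ffun 'I_d -> {set 'I_N}} | p.2 \in family F].
have [|Z' Z'Z [cardZ' Z'const]] :=
  @pigeonhole _ _ D (fun z => (lab z, upd (B z) j set0)) Z.
  move=> z zZ; rewrite inE /=; apply/familyP => k; rewrite updE /F.
  case: eqVneq => [_|kj]; first by rewrite inE.
  by have [? ?] := hB z k zZ kj; rewrite inE; apply/andP; split=> //; apply/eqP.
exists Z' => //; split.
  apply: (leq_trans cardZ'); rewrite leq_mul2r; apply/orP; right.
  have -> : D = finset.setX [set: K] [set B in family F].
    by apply/setP=> p; rewrite !inE.
  rewrite cardsX cardsT leq_mul2l; apply/orP; right.
  rewrite cardsE card_family foldrE big_image /= (bigD1 j) //= {1}/F eqxx cards1 mul1n.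
  apply: leq_prod => k kj; rewrite /F (negbTE kj) cards_draws.
  by apply: leq_trans (bin_leq_expn _ _) _.
move=> z z' zZ z'Z; have /= [-> e] := Z'const z z' zZ z'Z; split=> // k kj.
by have := congr1 (fun g : {ffun _ -> _} => g k) e; rewrite !updE (negbTE kj).
Qed.

(** Sub-boxes in which only the coordinates below j are free: the others are
    fixed to those of v by means of singleton sides.  Partial products are thus
    treated as sub-boxes of full dimension, and the inductions on j never change
    the vertex type. *)
Definition fits {d N : nat} (U : 'I_d -> {set 'I_N}) (L : nat -> nat)
    (v : vertex d N) (j : nat) (B : {ffun 'I_d -> {set 'I_N}}) : Prop :=
  forall k : 'I_d, B k \subset (if k < j then U k else [set v k]) /\
                   #|B k| = if k < j then L k else 1.

Lemma fits_singleton {d N : nat} {U L} {v : vertex d N} {j B} (k : 'I_d) :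
  fits U L v j B -> j <= k -> B k = [set v k].
Proof.
move=> /(_ k) [sB cB]; rewrite leqNgt => /negbTE kj; rewrite kj in sB cB.
by apply/eqP; rewrite eqEcard sB cB cards1.
Qed.

Lemma card_subbox_fits {d N : nat} {U L} {v : vertex d N} {j B} :
  fits U L v j B -> #|subbox B| = \prod_(k : 'I_d | k < j) L k.
Proof.
move=> fB; rewrite card_subbox [RHS]big_mkcond /=.
by apply: eq_bigr => k _; have [_ ->] := fB k.
Qed.

(** The induction step shared by both halves of the proof.  Given, for every value
    z of coordinate j, a sub-box of the slice at z and a label, the pigeonhole
    principle selects a set Z' of values z whose sub-boxes agree outside
    coordinate j and whose labels agree.  Any subset Y of Z' of size L j
    may then be used as side j of a sub-box, each of whose slices, moved to a
    point z of Z', lies in the given sub-box of z. *)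
Lemma glue_tails {d N : nat} {K : finType} (U : 'I_d -> {set 'I_N})
    (L : nat -> nat) (v : vertex d N) (j : 'I_d)
    (B : 'I_N -> {ffun 'I_d -> {set 'I_N}}) (lab : 'I_N -> K) (Z : {set 'I_N}) :
  Z \subset U j -> (forall z, z \in Z -> fits U L (upd v j z) j (B z)) ->
  exists2 Z' : {set 'I_N}, Z' \subset Z &
    #|Z| <= #|K| * (\prod_(k : 'I_d | k < j) #|U k| ^ L k) * #|Z'| /\
    forall (z0 : 'I_N) (Y : {set 'I_N}), z0 \in Z' -> Y \subset Z' -> #|Y| = L j ->
      [/\ fits U L v j.+1 (upd (B z0) j Y),
          forall z, z \in Z' -> lab z = lab z0,
          forall z k, z \in Z' -> k != j -> B z k = B z0 k &
          forall x, x \in subbox (upd (B z0) j Y) ->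
            forall z, z \in Z' -> upd x j z \in subbox (B z)].
Proof.
move=> ZU fB.
pose W (k : 'I_d) := if k < j then U k else [set v k].
pose m (k : 'I_d) := if k < j then L k else 1.
have [|Z' Z'Z [cardZ' Z'eq]] := pigeonhole_subboxes j W m B lab Z.
  by move=> z k zZ kj; have := fB z zZ k; rewrite updE (negbTE kj).
exists Z' => //; split.
  apply: (leq_trans cardZ'); rewrite leq_mul2r leq_mul2l; apply/orP; right; apply/orP; right.
  rewrite (bigID (fun k : 'I_d => k < j)) /= [X in _ * X]big1 ?muln1.
    rewrite leq_eqVlt; apply/orP; left; apply/eqP; apply: eq_big => [k|k /andP[_ kj]].
      by case: eqVneq => [->|_] //=; rewrite ltnn.
    by rewrite /W /m kj.
  by move=> k /andP[_ /negbTE kj]; rewrite /W /m kj cards1.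
move=> z0 Y z0Z' YZ' cardY; split.
- move=> k; rewrite updE; case: eqVneq => [->|kj].
    rewrite ltnSn; split=> //.
    exact: subset_trans YZ' (subset_trans Z'Z ZU).
  have := fB z0 (subsetP Z'Z _ z0Z') k.
  by rewrite updE (negbTE kj) ltnS [k <= j]leq_eqVlt val_eqE (negbTE kj).
- by move=> z zZ'; have [] := Z'eq z z0 zZ' z0Z'.
- by move=> z k zZ'; have [_] := Z'eq z z0 zZ' z0Z'; apply.
- move=> x /subboxP xB z zZ'; apply/subboxP => k; rewrite updE.
  have [kj|kj] := eqVneq k j.
    by rewrite kj (fits_singleton _ (fB z (subsetP Z'Z _ zZ')) (leqnn j)) updE eqxx inE.
  have [_ ->//] := Z'eq z z0 zZ' z0Z'.
  by have := xB k; rewrite updE (negbTE kj).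
Qed.

(** * Edge colours determined by the lower endpoint *)

(** Directions other than 0 have edge colours that depend only on the lower
    endpoint.  Direction 0 is exempt: it can only be made so at an exponential
    cost that would propagate to all later coordinates. *)
Definition source_determined {d N r : nat}
    (c : 'I_d.+1 -> vertex d.+1 N -> 'I_N -> 'I_r) (B : 'I_d.+1 -> {set 'I_N}) : Prop :=
  forall x i (b b' : 'I_N), x \in subbox B -> i != ord0 -> b \in B i -> b' \in B i ->
    x i < b -> x i < b' -> c i x b = c i x b'.

(** The hypothesis on P j is what one step consumes: the first factor counts the
    possible sides of the slices, and the second is the size at which the
    argument of Erdos and Rado yields L j points when colours are vectors
    indexed by the vertices of a slice. *)
Lemma source_determined_exists {d N r : nat}
    (c : 'I_d.+1 -> vertex d.+1 N -> 'I_N -> 'I_r) (L P : nat -> nat) :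
  1 < r -> (forall k, 0 < L k) -> (forall k, 0 < P k) ->
  (forall k, k <= d -> P k <= N) -> L 0 <= P 0 ->
  (forall j, 0 < j <= d ->
     (\prod_(k : 'I_d.+1 | k < j) P k ^ L k) *
       (r ^ \prod_(k : 'I_d.+1 | k < j) L k) ^ L j <= P j) ->
  forall (j : nat) (v : vertex d.+1 N), j <= d ->
    exists2 B, fits (fun k : 'I_d.+1 => initial (P k)) L v j.+1 B & source_determined c B.
Proof.
move=> r1 L0 P0 PN LP0 LP; elim=> [|j IHj] v jd.
  have [|S0 S0P cardS0] := subset_of_card (@initial N (P 0)) (L 0).
    by rewrite card_initial ?PN.
  exists (upd [ffun k => [set v k]] ord0 S0) => [k|x i b b' xB i0].
    rewrite updE; case: eqVneq => [->|] //.
    by rewrite -val_eqE /= ltnS leqn0 => /negbTE ->; rewrite ffunE cards1.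
  by rewrite updE (negbTE i0) ffunE !inE => /eqP -> /eqP ->.
have jd1 : j.+1 < d.+1 by [].
pose J : 'I_d.+1 := Ordinal jd1.
set U := fun k : 'I_d.+1 => @initial N (P k).
rewrite -/U in IHj.
have IH z : exists B, fits U L (upd v J z) J B /\ source_determined c B.
  by have [B fB sB] := IHj (upd v J z) (ltnW jd); exists B.
have [B BP] := boolp.choice IH.
have [Z' Z'Z [cardZ' Z'P]] :=
    glue_tails U L v J B (fun=> tt) (U J) (subxx _) (fun z _ => (BP z).1).
set D := \prod_(k : 'I_d.+1 | k < J) L k.
have D0 : 0 < D by apply: prodn_cond_gt0.
have r1D : 1 < r ^ D by rewrite -(expn0 r) ltn_exp2l.
have big : (r ^ D) ^ L J <= #|Z'|.
  rewrite card_unit mul1n [#|U J|]card_initial ?PN // in cardZ'.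
  have := leq_trans (LP J jd) cardZ'.
  have -> : \prod_(k : 'I_d.+1 | k < J) #|U k| ^ L k = \prod_(k : 'I_d.+1 | k < J) P k ^ L k.
    by apply: eq_bigr => k _; rewrite card_initial // PN // -ltnS.
  have PL0 : 0 < \prod_(k : 'I_d.+1 | k < J) P k ^ L k.
    by apply: prodn_cond_gt0 => k _; rewrite expn_gt0 P0.
  by rewrite leq_pmul2l.
have /card_gt0P [z0 z0Z'] : 0 < #|Z'|.
  by apply: (leq_trans _ big); rewrite !expn_gt0 ltnW.
have fz0 := (BP z0).1.
(* All slices over Z' have the same sides in the other coordinates, hence they
   can all be parametrised by the slice at z0. *)
pose chi a b := [ffun x : {x | x \in subbox (B z0)} => c J (upd (val x) J a) b].
have [|Y YZ' [cardY [f fP]]] := min_colouring chi (r ^ D) (L J) Z' r1D _ big.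
  by rewrite card_ffun card_ord card_sig (card_subbox_fits fz0).
have [fY _ eqB subY] := Z'P z0 Y z0Z' YZ' cardY.
exists (upd (B z0) J Y) => // x i b b' xB i0.
have xJ : x J \in Y by move/subboxP: (xB) => /(_ J); rewrite updE eqxx.
rewrite updE; case: eqVneq => [->|iJ] bB b'B xb xb'.
  have x0 := subY x xB z0 z0Z'.
  pose x' : {x | x \in subbox (B z0)} := Sub (upd x J z0) x0.
  have key a : a \in Y -> x J < a -> c J x a = f (x J) x'.
    by move=> aY xa; rewrite -(fP (x J) a xJ aY xa) ffunE /= upd_upd updK.
  by rewrite !key.
have xz := subY x xB (x J) (subsetP YZ' _ xJ); rewrite updK in xz.
rewrite -(eqB (x J)) ?(subsetP YZ' _ xJ) // in bB b'B.
exact: (BP (x J)).2 xz i0 bB b'B xb xb'.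
Qed.

(** * Monochromatic sub-boxes *)

(** Here f x i stands for the common colour of the edges that go up from x in a
    direction i other than 0, and chi is the colouring of direction 0; kappa
    collects the final colour of every direction. *)
Definition aligned {d N r : nat} (chi : vertex d.+1 N -> 'I_N -> 'I_r)
    (f : vertex d.+1 N -> {ffun 'I_d.+1 -> 'I_r}) (kappa : {ffun 'I_d.+1 -> 'I_r})
    (A : 'I_d.+1 -> {set 'I_N}) : Prop :=
  forall x, x \in subbox A ->
    (forall i, i != ord0 -> f x i = kappa i) /\
    (forall b : 'I_N, b \in A ord0 -> x ord0 < b -> chi x b = kappa ord0).

(** The hypothesis on L 0 pays for pigeonhole on the vertex colours followed by
    Ramsey's theorem in direction 0; the hypothesis on L j pays for agreement of
    the n-sets and of the colours chosen in the slices over n values of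
    coordinate j. *)
Lemma aligned_exists {d N r n : nat} (chi : vertex d.+1 N -> 'I_N -> 'I_r)
    (f : vertex d.+1 N -> {ffun 'I_d.+1 -> 'I_r})
    (S : 'I_d.+1 -> {set 'I_N}) (L : nat -> nat) :
  1 < r -> 0 < n -> (forall k, 0 < L k) -> (forall k, #|S k| = L k) ->
  r ^ d.+1 * r ^ (r * n) <= L 0 ->
  (forall j, 0 < j <= d ->
     n * (r ^ d.+1 * \prod_(k : 'I_d.+1 | k < j) L k ^ n) <= L j) ->
  forall (j : nat) (v : vertex d.+1 N), j <= d ->
    exists A, fits S (fun=> n) v j.+1 A /\ exists kappa, aligned chi f kappa A.
Proof.
move=> r1 n0 L0 cardS LL0 LL; elim=> [|j IHj] v jd.
  have [Z' Z'S [cardZ' fconst]] :=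
    @pigeonhole _ _ [set: {ffun 'I_d.+1 -> 'I_r}] (fun z => f (upd v ord0 z))
      (S ord0) (fun z _ => in_setT _).
  have big : r ^ (r * n) <= #|Z'|.
    have rd0 : 0 < r ^ d.+1 by rewrite expn_gt0 ltnW.
    rewrite -(leq_pmul2l rd0); apply: leq_trans LL0 _.
    by move: cardZ'; rewrite cardsT card_ffun !card_ord cardS.
  have [Y YZ' [cardY [k kP]]] := ramsey (fun a b => chi (upd v ord0 a) b) n Z' r1 n0 big.
  have [z0 z0Y] : exists z, z \in Y by apply/card_gt0P; rewrite cardY.
  exists (upd [ffun k => [set v k]] ord0 Y); split.
    move=> i; rewrite updE; case: eqVneq => [->|].
      by rewrite cardY; split=> //; exact: subset_trans YZ' Z'S.
    by rewrite -val_eqE /= ltnS leqn0 => /negbTE ->; rewrite ffunE cards1.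
  exists (upd (f (upd v ord0 z0)) ord0 k) => x /subboxP xA.
  have xY : x ord0 \in Y by have := xA ord0; rewrite updE eqxx.
  have {xA} -> : x = upd v ord0 (x ord0).
    apply/ffunP => i; rewrite updE; case: eqVneq => [->//|i0].
    by have := xA i; rewrite updE (negbTE i0) ffunE inE => /eqP.
  split=> [i i0|b]; rewrite !updE ?eqxx.
    by rewrite (negbTE i0) (fconst _ z0) // (subsetP YZ').
  by move=> bY xb; apply: kP.
have jd1 : j.+1 < d.+1 by [].
pose J : 'I_d.+1 := Ordinal jd1.
have IH z : exists p : {ffun 'I_d.+1 -> {set 'I_N}} * {ffun 'I_d.+1 -> 'I_r},
    fits S (fun=> n) (upd v J z) J p.1 /\ aligned chi f p.2 p.1.
  by have [A [fA [k kA]]] := IHj (upd v J z) (ltnW jd); exists (A, k).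
have [B BP] := boolp.choice IH.
have [Z' Z'S [cardZ' Z'P]] :=
    glue_tails S (fun=> n) v J (fun z => (B z).1) (fun z => (B z).2) (S J)
      (subxx _) (fun z _ => (BP z).1).
have big : n <= #|Z'|.
  rewrite cardS card_ffun !card_ord in cardZ'.
  have := leq_trans (LL J jd) cardZ'.
  have -> : \prod_(k : 'I_d.+1 | k < J) #|S k| ^ n = \prod_(k : 'I_d.+1 | k < J) L k ^ n.
    by apply: eq_bigr => k _; rewrite cardS.
  have PL0 : 0 < r ^ d.+1 * \prod_(k : 'I_d.+1 | k < J) L k ^ n.
    rewrite muln_gt0 expn_gt0 ltnW //=.
    by apply: prodn_cond_gt0 => k _; rewrite expn_gt0 L0.
  by rewrite mulnC leq_pmul2l.
have [Y YZ' cardY] := subset_of_card _ _ big.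
have [z0 z0Y] : exists z, z \in Y by apply/card_gt0P; rewrite cardY.
have [fY labY eqB subY] := Z'P z0 Y (subsetP YZ' _ z0Y) YZ' cardY.
exists (upd (B z0).1 J Y); split=> //; exists (B z0).2 => x xB.
have xJ : x J \in Z'.
  by apply: (subsetP YZ'); move/subboxP: (xB) => /(_ J); rewrite updE eqxx.
have xz := subY x xB (x J) xJ; rewrite updK in xz.
have [al1 al0] := (BP (x J)).2 x xz.
rewrite -(labY _ xJ); split=> // b; rewrite updE /= -(eqB _ ord0 xJ) //.
exact: al0.
Qed.

Lemma monochromatic_subbox_exists {d N r n : nat}
    (c : 'I_d.+1 -> vertex d.+1 N -> 'I_N -> 'I_r) (L P : nat -> nat) :
  1 < r -> 0 < n -> (forall k, 0 < L k) -> (forall k, 0 < P k) ->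
  (forall k, k <= d -> P k <= N) -> L 0 <= P 0 ->
  (forall j, 0 < j <= d ->
     (\prod_(k : 'I_d.+1 | k < j) P k ^ L k) *
       (r ^ \prod_(k : 'I_d.+1 | k < j) L k) ^ L j <= P j) ->
  r ^ d.+1 * r ^ (r * n) <= L 0 ->
  (forall j, 0 < j <= d ->
     n * (r ^ d.+1 * \prod_(k : 'I_d.+1 | k < j) L k ^ n) <= L j) ->
  exists A : 'I_d.+1 -> {set 'I_N}, (forall i, #|A i| = n) /\
    forall i, exists k, forall x (b : 'I_N),
      x \in subbox A -> b \in A i -> x i < b -> c i x b = k.
Proof.
move=> r1 n0 L0 P0 PN LP0 LP LL0 LL.
have N0 : 0 < N by apply: leq_trans (P0 0) (PN 0 _).
pose v : vertex d.+1 N := [ffun=> Ordinal N0].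
have [S fS sdS] := source_determined_exists c L P r1 L0 P0 PN LP0 LP d v (leqnn d).
have cardS k : #|S k| = L k by have [_ ->] := fS k; rewrite ltn_ord.
(* The default value occurs only when no edge of the sub-box goes up from x in
   direction i. *)
pose f x := [ffun i => c i x (odflt (x i) [pick b in S i | x i < b])].
have [A [fA [kappa al]]] := aligned_exists (c ord0) f S L r1 n0 L0 cardS LL0 LL d v (leqnn d).
exists A; split=> [i|i]; first by have [_ ->] := fA i; rewrite ltn_ord.
exists (kappa i) => x b xA bA xb.
have AS k : A k \subset S k by have [] := fA k; rewrite ltn_ord.
have [al1 al0] := al x xA.
have [i0|i0] := eqVneq i ord0; first by rewrite i0 in bA xb *; exact: al0.
have xS : x \in subbox S.
  by move/subboxP: xA => xA; apply/subboxP => k; apply: (subsetP (AS k)).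
rewrite -al1 // ffunE; case: pickP => [b' /andP[b'S xb']|/(_ b)] /=.
  by apply: sdS => //; apply: (subsetP (AS i)).
by rewrite (subsetP (AS i) _ bA) xb.
Qed.

(** * From edges to vertex pairs *)

Definition edge_colour {d N r : nat} (c : edge d N -> 'I_r) (dflt : 'I_r)
    (i : 'I_d) (x : vertex d N) (b : 'I_N) : 'I_r :=
  odflt dflt (omap c (insub [set x; upd x i b])).

(** Transfers statements about pairs (x, b) with x_i < b to all edges of a
    sub-box: the two endpoints of an edge are ordered by their i-th coordinates. *)
Lemma edge_colourE {d N r : nat} (c : edge d N -> 'I_r) (dflt : 'I_r) (e : edge d N)
    (i : 'I_d) (A : 'I_d -> {set 'I_N}) :
  val e \subset subbox A -> in_direction e i ->
  exists x b, [/\ x \in subbox A, b \in A i, x i < b & edge_colour c dflt i x b = c e].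
Proof.
move=> eA /existsP [v /existsP [w /andP[/eqP vw /eqP ew]]].
wlog lt : v w vw ew / v i < w i.
  move=> hw; case: (ltngtP (v i) (w i)) => [|lt|/val_inj eqi]; first exact: hw.
    apply: (hw w v) => //; last by rewrite setUC.
    by rewrite -vw; apply/setP=> k; rewrite !inE eq_sym.
  by have := set11 i; rewrite -vw inE eqi eqxx.
have /subboxP wA : w \in subbox A by apply: (subsetP eA); rewrite ew !inE eqxx orbT.
exists v, (w i); split=> //; first by apply: (subsetP eA); rewrite ew !inE eqxx.
have upd_w : upd v i (w i) = w.
  apply/ffunP => k; rewrite updE; case: eqVneq => [->//|ki].
  by move/setP/(_ k): vw; rewrite !inE (negbTE ki) => /negbFE/eqP.
by rewrite /edge_colour upd_w -ew valK.
Qed.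

(** * Choice of the sizes *)

(** The exponent of L_j: the factor 3 n absorbs, at each step, the n-th power of
    the previous size together with the sum of all earlier contributions. *)
Definition side_exponent (d n r j : nat) := 2 * d.+1 * (r * n) * (3 * n) ^ j.

(** The exponent of P_j, with M = r^(side_exponent d n r d) bounding every
    L_k: the term M^(d+1) bounds the number of vertices of the sub-box, and the factor 2 M
    accounts for the L_k-th powers of the earlier P_k. *)
Definition range_exponent (d n r j : nat) :=
  (r ^ side_exponent d n r d) ^ d.+1 * (2 * r ^ side_exponent d n r d) ^ j.

Lemma sum_ord_lt (d j : nat) (F : nat -> nat) : j <= d ->
  \sum_(k : 'I_d | k < j) F k = \sum_(k < j) F k.
Proof. by move=> jd; rewrite (big_ord_widen _ F jd). Qed.

Lemma side_exponent_sum (d n r j : nat) : 0 < n -> 0 < r ->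
  n + d.+1 + \sum_(k < j) side_exponent d n r k * n <= side_exponent d n r j.
Proof.
move=> n0 r0; elim: j => [|j IHj].
  by rewrite big_ord0 /side_exponent expn0; nia.
rewrite big_ord_recr /= addnA.
have -> : side_exponent d n r j.+1 = side_exponent d n r j * (3 * n).
  by rewrite /side_exponent expnSr mulnA.
by apply: leq_trans (leq_add IHj (leqnn _)) _; nia.
Qed.

Lemma range_exponent_sum (d n r j : nat) : 0 < r ->
  (r ^ side_exponent d n r d) ^ d.+1 +
      \sum_(k < j) range_exponent d n r k * r ^ side_exponent d n r d
    <= range_exponent d n r j.
Proof.
move=> r0; elim: j => [|j IHj]; first by rewrite big_ord0 /range_exponent expn0 muln1 addn0.
rewrite big_ord_recr /= addnA.
have -> : range_exponent d n r j.+1 =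
          range_exponent d n r j * (2 * r ^ side_exponent d n r d).
  by rewrite /range_exponent [_ ^ j.+1]expnSr mulnA.
have : 0 < r ^ side_exponent d n r d by rewrite expn_gt0 r0.
by move=> M0; apply: leq_trans (leq_add IHj (leqnn _)) _; nia.
Qed.

(** Since 2 M <= M^2, every P_j is at most r^(M^(3 (d+1))); three times d + 1 times
    the exponent of M, which is 2 (d+1) 3^d r n^(d+1), has this constant as its
    coefficient. *)
Definition bound_constant (d : nat) := 6 * d.+1 ^ 2 * 3 ^ d.

(** * The double exponential bound *)

Lemma ramsey_property_double_exp {d n r N : nat} : 1 < r -> 0 < n ->
  r ^ (r ^ (bound_constant d * (r * n ^ d.+1))) <= N -> ramsey_property r d.+1 n N.
Proof.
move=> r1 n0 hN c; have r0 := ltnW r1.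
have dflt : 'I_r := Ordinal r0.
have l0 j : 0 < side_exponent d n r j by rewrite !muln_gt0 expn_gt0 muln_gt0 n0 r0.
have lmono j : j <= d -> side_exponent d n r j <= side_exponent d n r d.
  by move=> jd; rewrite leq_mul2l leq_pexp2l ?orbT // muln_gt0.
set M := r ^ side_exponent d n r d.
have M2 : 2 <= M by apply: (leq_trans r1); rewrite /M -[leqLHS]expn1 leq_exp2l.
pose L j := r ^ side_exponent d n r j; pose P j := r ^ range_exponent d n r j.
have L0 k : 0 < L k by rewrite expn_gt0 r0.
have P0 k : 0 < P k by rewrite expn_gt0 r0.
have PN k : k <= d -> P k <= N.
  move=> kd; apply: leq_trans hN; rewrite leq_exp2l //.
  apply: (@leq_trans (M ^ (3 * d.+1))).
    have MM : 2 * M <= M ^ 2 by rewrite expnS expn1 leq_mul2r M2 orbT.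
    have -> : 3 * d.+1 = d.+1 + 2 * d.+1 by rewrite -mulSn.
    rewrite expnD [M ^ (2 * _)]expnM leq_mul2l; apply/orP; right.
    apply: leq_trans (_ : (M ^ 2) ^ k <= _); first by case: (k) => // k'; rewrite leq_exp2r.
    by rewrite leq_pexp2l ?expn_gt0 ?(ltnW M2) // ltnW.
  rewrite /M -expnM leq_exp2l // /side_exponent /bound_constant expnMn !expnS expn0; lia.
have LP0 : L 0 <= P 0.
  rewrite leq_exp2l // /range_exponent expn0 muln1; apply: leq_trans (lmono 0 (leq0n d)) _.
  apply: leq_trans (ltnW (ltn_expl _ r1)) _.
  by rewrite -/M -[leqLHS]expn1 leq_exp2l.
have LP j : 0 < j <= d ->
     (\prod_(k : 'I_d.+1 | k < j) P k ^ L k) *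
       (r ^ \prod_(k : 'I_d.+1 | k < j) L k) ^ L j <= P j.
  move=> /andP[j0 jd].
  under eq_bigr do rewrite /P -expnM.
  rewrite -expn_sum -expnM -expnD leq_exp2l //.
  rewrite (sum_ord_lt _ _ (fun k => range_exponent d n r k * L k)) ?(leqW jd) //.
  apply: leq_trans (range_exponent_sum d n r j r0); rewrite addnC.
  apply: leq_add; last first.
    apply: leq_sum => k _; rewrite leq_mul2l leq_exp2l // lmono ?orbT //.
    by apply: leq_trans jd; exact: ltnW.
  rewrite -expn_sum -expnD (sum_ord_lt _ _ (side_exponent d n r)) ?(leqW jd) //.
  rewrite -expnM leq_exp2l // -(big_ord_recr _ (fun k : 'I_j.+1 => side_exponent d n r k)) /=.
  apply: leq_trans (_ : \sum_(k < j.+1) side_exponent d n r d <= _).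
    by apply: leq_sum => k _; apply: lmono; apply: leq_trans jd; rewrite -ltnS.
  by rewrite sum_nat_const card_ord mulnC leq_mul2l ltnS jd orbT.
have LL0 : r ^ d.+1 * r ^ (r * n) <= L 0.
  rewrite -expnD leq_exp2l // /side_exponent expn0; nia.
have LL j : 0 < j <= d ->
     n * (r ^ d.+1 * \prod_(k : 'I_d.+1 | k < j) L k ^ n) <= L j.
  move=> /andP[j0 jd].
  under eq_bigr do rewrite /L -expnM.
  rewrite -expn_sum -expnD (sum_ord_lt _ _ (fun k => side_exponent d n r k * n)) ?(leqW jd) //.
  apply: leq_trans (leq_mul (ltnW (ltn_expl n r1)) (leqnn _)) _.
  by rewrite -expnD leq_exp2l // addnA side_exponent_sum.
have [A [cardA monoA]] := monochromatic_subbox_exists (edge_colour c dflt) L P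
  r1 n0 L0 P0 PN LP0 LP LL0 LL.
exists A; split=> // i; have [k kP] := monoA i; exists k => e eA ei.
have [x [b [xA bA xb <-]]] := edge_colourE c dflt e i A eA ei.
exact: kP.
Qed.

Lemma ramsey_property_single {d r N : nat} : 0 < r -> 0 < N -> ramsey_property r d 1 N.
Proof.
move=> r0 N0 c; exists (fun=> [set Ordinal N0]); split=> [i|i]; first by rewrite cards1.
exists (Ordinal r0) => e eA ei.
have [x [b [/subboxP xA]]] := edge_colourE c (Ordinal r0) e i _ eA ei.
by have := xA i; rewrite !inE => /eqP -> /eqP ->; rewrite ltnn.
Qed.

Lemma is_ramsey_number_exists {r d n X : nat} :
  (forall N, X <= N -> ramsey_property r d n N) ->
  exists2 M, is_ramsey_number r d n M & M <= X.
Proof.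
move=> hX.
have ex : exists N, boolp.asbool (ramsey_property r d n N).
  by exists X; apply/boolp.asboolP/hX.
case: (ex_minnP ex) => M /boolp.asboolP hM Mmin.
exists M; last by apply/Mmin/boolp.asboolP/hX.
by split=> // N hN; apply/Mmin/boolp.asboolP.
Qed.

From mathcomp Require Import all_order all_algebra.
From mathcomp Require Import all_classical all_reals all_analysis.
Import Order.TTheory GRing.Theory Num.Theory.
Local Open Scope ring_scope.

(* The literal claim is false for r = 1 and n > 1: the bound is then 1, while
   a copy needs N >= n.  The hypothesis 1 < r or n = 1 removes exactly these
   instances. *)
Theorem theorem1p1 (R : realType) (d : nat) (hd : (0 < d)%N) :
  exists C : R, 0 < C /\
    forall n r : nat, (0 < n)%N -> (0 < r)%N -> (1 < r)%N \/ n = 1%N ->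
      (forall N : nat,
         r%:R `^ (r%:R `^ (C * r%:R * n%:R ^+ d)) <= N%:R :> R ->
         ramsey_property r d n N) /\
      (exists M : nat, is_ramsey_number r d n M /\
         M%:R <= r%:R `^ (r%:R `^ (C * r%:R * n%:R ^+ d)) :> R).
Proof.
case: d hd => // d _; exists (bound_constant d)%:R; split.
  by rewrite ltr0n !muln_gt0 !expn_gt0.
move=> n r n0 r0 hrn.
(* With an integer C the real bound is itself an integer, so no rounding is
   needed to bound the minimal M by it. *)
pose X := (r ^ (r ^ (bound_constant d * (r * n ^ d.+1))))%N.
have -> : r%:R `^ (r%:R `^ ((bound_constant d)%:R * r%:R * n%:R ^+ d.+1)) = X%:R :> R.
  by rewrite -mulrA -!(natrX, natrM) powR_mulrn ?ler0n // -natrX powR_mulrn ?ler0n // -natrX.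
have hX N : (X <= N)%N -> ramsey_property r d.+1 n N.
  move=> XN; case: hrn => [r1|n1]; first exact: ramsey_property_double_exp XN.
  rewrite n1; apply: ramsey_property_single => //.
  by apply: leq_trans XN; rewrite expn_gt0 r0.
split=> [N|]; first by rewrite ler_nat; exact: hX.
by have [M hM MX] := is_ramsey_number_exists hX; exists M; rewrite ler_nat.
Qed.
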